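(* Let $n\ge 2$ and for $a=(a_1,\dots,a_n)\in\mathbb{R}^n$, $b=(b_1,\dots,b_n)\in\mathbb{R}^n$ let $J=J(a,b)$ be the Jacobian of the directed $n$-node ring. Generically $J$ has no resonances. Indeed, for any fixed $a_1,\dots,a_n$, arbitrarily small perturbations of $b_1,\dots,b_n$ remove any resonances among the eigenvalues; that is, for all $a,b\in\mathbb{R}^n$ and every $\varepsilon>0$ there exists $b'\in\mathbb{R}^n$ with $\|b'-b\|<\varepsilon$ such that there are no real $\omega\ne 0$ and rational $k\neq\pm1$ for which $\mathrm{i}\omega$ and $k\mathrm{i}\omega$ are both eigenvalues of $J(a,b')$.
   Context: $J(a,b)$ is the real $n\times n$ matrix with $J_{jj}=a_j$ for $1\le j\le n$, $J_{j,j+1}=b_j$ for $1\le j\le n-1$, $J_{n,1}=b_n$, and all other entries $0$. It is the general form of the Jacobian of an ODE $\dot x_j=f_j(x_j,x_{j+1})$ (indices mod $n$) with each $x_j\in\mathbb{R}$ and independent functions $f_j$ (a fully inhomogeneous nearest-neighbour unidirectional ring). A resonance means that $\mathrm{i}\omega$ and $k\mathrm{i}\omega$ are both eigenvalues for some real $\omega\neq0$ and some rational $k\ne\pm1$. ''Generic'' means that the property can be realised after an arbitrarily small admissible perturbation, i.e. an arbitrarily small perturbation of the entries $a_j,b_j$. *)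

(* Defs.v *)
From HB Require Import structures.
From mathcomp Require Import all_boot all_order all_algebra.
From mathcomp Require Import complex.
From mathcomp Require Import reals topology normedtype.

Set Implicit Arguments.
Unset Strict Implicit.
Unset Printing Implicit Defensive.

Import Order.TTheory GRing.Theory Num.Theory.
Import numFieldNormedType.Exports.

Local Open Scope ring_scope.

(* [ordS j] is the cyclic successor of [j] in ['I_n], so the entry in the last
   row is b_n in column 1. For n >= 2, [j != ordS j], so no entry of [b] is
   shadowed by the diagonal. *)
Definition ring_jacobian (R : realType) (n : nat) (a b : 'rV[R]_n) : 'M[R]_n :=
  \matrix_(i, j) if j == i then a 0 i
                 else if j == ordS i then b 0 i
                 else 0.

(* The eigenvalues of a real matrix are those of its complexification. *)
Definition complex_eigenvalue (R : realType) (n : nat) (A : 'M[R]_n) (z : R[i])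
    : bool :=
  eigenvalue (map_mx (real_complex R) A) z.

(* k = 0 is allowed: a zero eigenvalue alongside iw counts as a resonance. *)
Definition has_resonance (R : realType) (n : nat) (A : 'M[R]_n) : Prop :=
  exists (w : R) (k : rat),
    [/\ w != 0, k != 1, k != -1,
        complex_eigenvalue A ('i%C * w%:C%C)
      & complex_eigenvalue A (ratr k * ('i%C * w%:C%C))].

(* Genericity is with respect to perturbations of the entries a_j, b_j only;
   the norm on ['rV[R]_n] is the max norm. *)
Definition generic_ring_jacobian (R : realType) (n : nat)
    (P : 'M[R]_n -> Prop) : Prop :=
  forall (a b : 'rV[R]_n) (eps : R), 0 < eps ->
    exists a' b' : 'rV[R]_n,
      [/\ `|a' - a| < eps, `|b' - b| < eps & P (ring_jacobian a' b')].

(* Main.v *)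
Require Import Defs.
From HB Require Import structures.
From mathcomp Require Import all_boot all_order all_algebra.
From mathcomp Require Import complex.
From mathcomp Require Import classical_sets boolp cardinality.
From mathcomp Require Import reals ereal topology normedtype.
From mathcomp Require Import lebesgue_measure.
From mathcomp Require Import ring.

Set Implicit Arguments.
Unset Strict Implicit.
Unset Printing Implicit Defensive.

Import Order.TTheory GRing.Theory Num.Theory.
Import numFieldNormedType.Exports.

Local Open Scope ring_scope.

(** Put [p(z) = (z - a_1) ... (z - a_n)]. Going once around the ring, an
    eigenvector equation multiplies up to [p(z) = b_1 ... b_n] as soon as no
    [b_j] vanishes. A resonance of ratio [k] thus forces [z] to be a root of
    [p(X) - p(kX)], which is nonzero because its coefficient of degree [n] is
    [1 - k^n]. For all [k] together this leaves only countably many possible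
    values of [b_1 ... b_n], so that the perturbation [b_j + t] avoids all of
    them for arbitrarily small [t]. *)

Lemma countable_roots (F : closedFieldType) (p : {poly F}) :
  p != 0 -> countable [set z | root p z]%classic.
Proof.
move=> p0; have [r pE] := closed_field_poly_normal p.
apply/finite_set_countable/(sub_finite_set _ (finite_seq r)) => z /=.
by rewrite pE rootZ ?lead_coef_eq0 // root_prod_XsubC.
Qed.

Lemma coef_comp_scaleX (A : comNzRingType) (p : {poly A}) (c : A) (i : nat) :
  (p \Po (c *: 'X))`_i = p`_i * c ^+ i.
Proof.
rewrite comp_polyE (eq_bigr (fun j : 'I__ => (p`_j * c ^+ j) *: 'X^j)).
  rewrite -(poly_def (size p) (fun j => p`_j * c ^+ j)) coef_poly.
  by case: ltnP => // /(nth_default 0) ->; rewrite mul0r.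
by move=> j _; rewrite exprZn scalerA.
Qed.

Lemma monic_neq_comp_scaleX (A : comNzRingType) (p : {poly A}) (c : A) :
  p \is monic -> c ^+ (size p).-1 != 1 -> p - (p \Po (c *: 'X)) != 0.
Proof.
move=> /monicP; rewrite /lead_coef => pm; rewrite subr_eq0.
apply: contraNneq => pE; rewrite -[X in X == 1]mul1r -[in X in X == 1]pm.
by rewrite -coef_comp_scaleX -pE pm.
Qed.

(** Taking absolute values, [|k| ^+ n = 1] with [n > 0] forces [|k| = 1]. This uses the order on the
    rationals: a complex ratio could be another root of unity. *)
Lemma expf_rat_neq1 (k : rat) (n : nat) :
  (0 < n)%N -> k != 1 -> k != -1 -> k ^+ n != 1.
Proof.
move=> n0 k1 kN1; apply: contraTneq isT => /(congr1 Num.norm).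
rewrite normrX normr1 => /eqP; rewrite pexpr_eq1 ?normr_ge0 //.
by rewrite eqr_norml (negPf k1) (negPf kN1).
Qed.

(** Otherwise the interval from 0 to [eps], of Lebesgue measure [eps > 0], would lie in a countable
    set, which is null. *)
Lemma exists_notin_countable (R : realType) (A : set R) (eps : R) :
  countable A -> 0 < eps -> exists t, [/\ 0 < t, t < eps & ~ A t].
Proof.
move=> Ac eps0; apply: contrapT => noex.
have sub : (`]0%R, eps[%classic `<=` A)%classic.
  move=> t /=; rewrite in_itv /= => /andP[t0 te].
  by apply: contrapT => At; apply: noex; exists t.
have := countable_lebesgue_measure0 (sub_countable (subset_card_le sub) Ac).
rewrite lebesgue_measure_itv /= lte_fin eps0 sube0 => /eqP.
by rewrite eqe (gt_eqF eps0).
Qed.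

Section RingEigenvalue.
Variables (R : realType) (n : nat).
Implicit Types a b : 'rV[R]_n.

Local Notation C := (R[i]).

Definition diag_poly a : {poly C} := \prod_(j < n) ('X - ((a 0 j)%:C%C)%:P).

Lemma diag_poly_monic a : diag_poly a \is monic.
Proof. exact: monic_prod_XsubC. Qed.

Lemma size_diag_poly a : size (diag_poly a) = n.+1.
Proof. by rewrite size_prod_XsubC /index_enum -enumT size_enum_ord. Qed.

Lemma eigenvalue_ring_jacobian a b (z : C) :
    (2 <= n)%N -> (forall j, b 0 j != 0) ->
  complex_eigenvalue (ring_jacobian a b) z ->
  (diag_poly a).[z] = \prod_(j < n) (b 0 j)%:C%C.
Proof.
move=> n2 b0 /eigenvalueP[v vJ v0].
have neq_ordS (i : 'I_n) : (ordS i == i) = false.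
  rewrite -val_eqE /=; case: (ltngtP i.+1 n) (ltn_ord i) => // [lt _|eqn _].
    by rewrite modn_small // gtn_eqF.
  by rewrite eqn modnn; case: (val i) eqn n2 => [<-|].
(* Eigenvectors are row vectors here, so the equation is read in column [ordS i], whose only
   possibly nonzero entries are [a] in row [ordS i] and [b] in row [i]. *)
have step i : (z - (a 0 (ordS i))%:C%C) * v 0 (ordS i)
              = (b 0 i)%:C%C * v 0 i.
  have := congr1 (fun u : 'rV_n => u 0 (ordS i)) vJ.
  rewrite !mxE (bigD1 (ordS i)) //= (bigD1 i) /=; last first.
    by rewrite eq_sym neq_ordS.
  rewrite big1 ?addr0 => [|j /andP[jS ji]].
    rewrite !mxE !eqxx neq_ordS mulrBl => <-; ring.
  rewrite !mxE [_ == j]eq_sym (negPf jS) (inj_eq (@ordS_inj n)).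
  by rewrite [i == j]eq_sym (negPf ji) rmorph0 mulr0.
have iter_val m (i : 'I_n) : val (iter m (@ordS n) i) = ((i + m) %% n)%N :> nat.
  elim: m => [|m IHm] /=; first by rewrite addn0 modn_small.
  by rewrite IHm -addn1 modnDml addn1 addnS.
(* As no [b 0 i] vanishes, [step] carries a zero coordinate back to its predecessor, hence all
   around the ring, contradicting [v != 0]. *)
have v_neq0 j : v 0 j != 0.
  apply: contraNneq v0 => vj0; apply/eqP/rowP => i; rewrite [RHS]mxE.
  have back m : v 0 (iter m (@ordS n) i) = 0 -> v 0 i = 0.
    elim: m => //= m IHm vS; apply: IHm; apply/eqP.
    have /esym/eqP := step (iter m (@ordS n) i); rewrite vS mulr0 mulf_eq0.
    by rewrite (fmorph_eq0 (real_complex R)) (negPf (b0 _)).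
  (* From [i], this many steps lead to [n + j], that is, to [j] modulo [n]; the detour by [n] avoids
     truncated subtraction when [j < i]. *)
  apply: (back (n - i + j)%N); rewrite -[RHS]vj0; congr (v 0 _); apply: val_inj.
  by rewrite iter_val addnA subnKC ?[(i <= n)%N]ltnW // modnDl modn_small.
apply: (mulIf (x := \prod_j v 0 j)); first by apply/prodf_neq0.
have ordS_on : {on [pred i : 'I_n | true], bijective (@ordS n)}.
  exact/onW_bij/ordS_bij.
(* Only the left-hand side is shifted by [ordS], so that the factors at [i] on both sides are those
   of [step]. *)
rewrite horner_prod [X in X * _](reindex _ ordS_on).
rewrite [X in _ * X](reindex _ ordS_on).
rewrite -!big_split; apply: eq_bigr => i _ /=.
by rewrite !hornerE step.
Qed.

(* The first union makes some [b_j + t] vanish, where the equation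
   [p(z) = b_1 ... b_n] is not available. *)
Definition bad_shift a b : set C :=
  ((\bigcup_j [set t | root ('X + ((b 0 j)%:C%C)%:P) t]) `|`
   \bigcup_(k in [set k : rat | k ^+ n != 1])
     \bigcup_(z in
        [set z | root (diag_poly a - (diag_poly a \Po (ratr k *: 'X))) z])
       [set t | root (\prod_(j < n) ('X + ((b 0 j)%:C%C)%:P) -
                     ((diag_poly a).[z])%:P) t])%classic.

Lemma countable_bad_shift a b : (0 < n)%N -> countable (bad_shift a b).
Proof.
move=> n0; rewrite /bad_shift.
have XD (c : C) : 'X + c%:P = 'X - (- c)%:P by rewrite polyCN opprK.
rewrite -bigcup2E; apply: bigcup_countable => // -[|[|i]] _ /=; last by [].
  apply: bigcup_countable => // j _.
  by apply: countable_roots; rewrite XD polyXsubC_eq0.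
apply: bigcup_countable => // k kn; apply: bigcup_countable => [|z _].
  apply: countable_roots; apply: monic_neq_comp_scaleX (diag_poly_monic a) _.
  by rewrite size_diag_poly -rmorphXn fmorph_eq1.
(* The product is monic of degree [n > 0], so subtracting the constant [p(z)] cannot make it
   vanish. *)
apply: countable_roots; rewrite -size_poly_gt0 size_polyDl.
  by rewrite (eq_bigr _ (fun j _ => XD _)) size_prod_XsubC.
rewrite (eq_bigr _ (fun j _ => XD _)) size_prod_XsubC size_polyN.
by rewrite /index_enum -enumT size_enum_ord (leq_ltn_trans (size_polyC_leq1 _)).
Qed.

Lemma nonresonant_shift a b (t : R) : (2 <= n)%N -> ~ bad_shift a b t%:C%C ->
  ~ has_resonance (ring_jacobian a (b + const_mx t)).
Proof.
move=> n2 tgood [w [k [w0 k1 kN1 ew ekw]]]; apply: tgood.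
have [|/forallPn[j]] := boolP [forall j, (b + const_mx t) 0 j != 0]; last first.
  rewrite negbK !mxE => /eqP bt; left; exists j => //=.
  by rewrite /root !hornerE -(rmorphD (real_complex R)) addrC bt.
move=> /forallP bt0; right; exists k; first exact: expf_rat_neq1 (ltnW n2) _ _.
move: ew ekw; set z := _ * _ => ew ekw.
have pz := eigenvalue_ring_jacobian n2 bt0 ew.
have pkz := eigenvalue_ring_jacobian n2 bt0 ekw.
(* Both [p(z)] and [p(kz)] equal the product of the shifted [b]: their equality makes [z] a root of
   [p(X) - p(kX)], and the value of [p(z)] makes [t] a root of the last polynomial. *)
exists z => /=.
  rewrite /root hornerD hornerN horner_comp hornerZ hornerX.
  by rewrite pz pkz subrr.
rewrite /root !hornerE horner_prod pz subr_eq0; apply/eqP/eq_bigr => j _.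
by rewrite !hornerE !mxE rmorphD addrC.
Qed.

End RingEigenvalue.

Lemma norm_const_mx_lt (R : realType) (m n : nat) (t eps : R) :
  `|t| < eps -> `|const_mx t : 'M[R]_(m, n)| < eps.
Proof.
move=> te; have : ball (0 : 'M[R]_(m, n)) eps (const_mx t).
  split=> [|i j]; first exact: le_lt_trans te.
  by rewrite -ball_normE /= !mxE sub0r normrN.
by rewrite -ball_normE /= sub0r normrN.
Qed.

Theorem theorem4p4 (R : realType) (n : nat) (hn : (2 <= n)%N) :
  generic_ring_jacobian (fun A : 'M[R]_n => ~ has_resonance A) /\
  (forall (a b : 'rV[R]_n) (eps : R), 0 < eps ->
     exists b' : 'rV[R]_n,
       `|b' - b| < eps /\ ~ has_resonance (ring_jacobian a b')).
Proof.
have perturb_b (a b : 'rV[R]_n) (eps : R) : 0 < eps ->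
    exists b' : 'rV[R]_n,
      `|b' - b| < eps /\ ~ has_resonance (ring_jacobian a b').
  move=> eps0.
  (* The bad shifts are complex, but [t] must be real; the embedding of the reals is injective, so
     the preimage stays countable. *)
  have /exists_notin_countable :
      countable (real_complex R @^-1` bad_shift a b)%classic.
    apply: sub_countable (card_ge_preimage _) (countable_bad_shift a b _).
      by move=> x y _ _ /complexI.
    exact: ltnW.
  move=> /(_ _ eps0)[t [t0 te tgood]]; exists (b + const_mx t); split.
    by rewrite addrC addKr norm_const_mx_lt // gtr0_norm.
  exact: nonresonant_shift.
split=> // a b eps eps0; have [b' [b'b res]] := perturb_b a b eps eps0.
by exists a, b'; rewrite subrr normr0.
Qed.
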